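(* Let $n\ge 2$, let $\lambda_1,\lambda_2,A,B>0$ be real constants with $\lambda_1A-\lambda_2B>0$, let $p_1,\dots,p_M\in\mathbb{Z}^n$ ($M\ge1$) be distinct points, let $n_1,\dots,n_M>0$ be real constants, and set $h_3=4\pi\sum_{j=1}^M n_j\delta_{p_j}$. Let $g(t)=\lambda_1e^{At}(e^{At}-1)+\lambda_2e^{-Bt}(e^{-Bt}-1)$ and let $s_0<0$ be its unique negative zero. Let $\delta\in(0,-s_0)$ and suppose that $4\pi\max_j n_j\le -g(s_0+\delta)$. Then there exists $\bar u:\mathbb{Z}^n\to\mathbb{R}$ satisfying $$-\Delta \bar u+\lambda_1\bigl(e^{A\bar u}-1\bigr)+\lambda_2\bigl(e^{-B\bar u}-1\bigr)+h_3=0\qquad\text{on }\mathbb{Z}^n$$ and $0\ge\bar u\ge u$ on $\mathbb{Z}^n$, where $u:\mathbb{Z}^n\to[s_0+\delta,0]$ is the solution, constructed as described in the context, of $$-\Delta u+\lambda_1e^{Au}(e^{Au}-1)+\lambda_2e^{-Bu}(e^{-Bu}-1)+h_3=0\qquad\text{on }\mathbb{Z}^n.$$ Furthermore, $\bar u$ has the same decay as $u$: there is a constant $\epsilon_0\in(0,1)$ such that, with $m=\log\bigl(1+\frac{\lambda_1A-\lambda_2B}{2n}\bigr)$, both $u(x)=O\bigl(e^{-m(1-\epsilon_0)d(x)}\bigr)$ and $$\bar u(x)=O\bigl(e^{-m(1-\epsilon_0)d(x)}\bigr).$$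
   Context: On $\mathbb{Z}^n$ write $d(x,y)=\sum_{i=1}^n|x_i-y_i|$ and $d(x)=d(x,0)$; $x\sim y$ means $d(x,y)=1$. The graph Laplacian is $\Delta u(x)=\sum_{y\sim x}(u(y)-u(x))$. $\delta_p$ is the function equal to $1$ at $p$ and $0$ elsewhere. $u(x)=O(e^{-ad(x)})$ means $|u(x)|\le Ce^{-ad(x)}$ for all $x\in\mathbb{Z}^n$ and some constant $C$. When $\lambda_1A-\lambda_2B>0$, $g$ has exactly two real zeros, $s_0<0$ and $0$, and $g<0$ on $(s_0,0)$. For finite $\Omega\subset\mathbb{Z}^n$, $\partial\Omega=\{y\in\mathbb{Z}^n\setminus\Omega:\exists x\in\Omega,\ y\sim x\}$ and $\overline\Omega=\Omega\cup\partial\Omega$. Construction of $u$. Let $L>0$ be sufficiently large (so that in particular $t\mapsto g(t)-Lt$ is decreasing on $[s_0+\delta,0]$). For a finite set $\Omega$, put $u_0=0$ and let $u_k:\overline\Omega\to\mathbb{R}$ be the unique solution of $(\Delta-L)u_k=g(u_{k-1})+h_3-Lu_{k-1}$ on $\Omega$, $u_k=0$ on $\partial\Omega$. The sequence $(u_k)$ is nonincreasing with values in $[s_0+\delta,0]$; let $u_\Omega$ be its pointwise limit. Let $\Omega_0\subset\Omega_1\subset\cdots$ be finite connected subsets of $\mathbb{Z}^n$ with $\{p_1,\dots,p_M\}\subset\Omega_0$ and $\bigcup_i\Omega_i=\mathbb{Z}^n$. Extending each $u_{\Omega_k}$ by $0$ outside $\Omega_k$ gives a nonincreasing sequence of functions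 on $\mathbb{Z}^n$ with values in $[s_0+\delta,0]$, and $u$ is its pointwise limit. *)

(* Defs.v *)
From HB Require Import structures.
From mathcomp Require Import all_boot all_order all_algebra.
From mathcomp Require Import all_classical all_reals all_analysis.
Import Order.TTheory GRing.Theory Num.Theory.
Import numFieldNormedType.Exports.

Set Implicit Arguments.
Unset Strict Implicit.
Unset Printing Implicit Defensive.

Local Open Scope classical_set_scope.
Local Open Scope ring_scope.

Notation lattice n := 'rV[int]_n.

(* In ssrint's [`|a - b|%N] the subtraction is that of [int]; only the absolute
   value lands in [nat]. *)
Definition dist (n : nat) (x y : lattice n) : nat :=
  (\sum_(i < n) `|x 0%R i - y 0%R i|)%N.

Definition adj (n : nat) : rel (lattice n) := fun x y => dist x y == 1%N.

(* Finitely supported sum of fsbigop; a point has only [2 * n] neighbours. *)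
Definition laplacian (R : realType) (n : nat) (u : lattice n -> R)
    (x : lattice n) : R :=
  \sum_(y \in [set y | adj x y]) (u y - u x).

Definition vertex_boundary (n : nat) (Omega : set (lattice n)) :
    set (lattice n) :=
  [set y | ~ Omega y /\ exists2 x, Omega x & adj x y].

Definition graph_connected (n : nat) (Omega : set (lattice n)) : Prop :=
  forall x y, Omega x -> Omega y ->
    exists s : seq (lattice n),
      [/\ path (@adj n) x s, last x s = y & forall z, z \in s -> Omega z].

Definition exp_decay (R : realType) (n : nat) (a : R) (u : lattice n -> R) :
    Prop :=
  exists C : R, forall x, `|u x| <= C * expR (- a * (dist x 0)%:R).

Definition g (R : realType) (lam1 lam2 A B t : R) : R :=
  lam1 * expR (A * t) * (expR (A * t) - 1)
  + lam2 * expR (- B * t) * (expR (- B * t) - 1).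

Definition h3 (R : realType) (n M : nat) (p : 'I_M -> lattice n)
    (mult : 'I_M -> R) (x : lattice n) : R :=
  4 * pi * \sum_(j < M) mult j * (x == p j)%:R.

(* [v] solves [(Delta - L) v = f] on [Omega] with [v = 0] on the boundary.
   A function on the closure of [Omega] is represented by its extension by 0
   to the whole lattice, which the last clause expresses. *)
Definition dirichlet_solution (R : realType) (n : nat) (L : R)
    (Omega : set (lattice n)) (f v : lattice n -> R) : Prop :=
  [/\ forall x, Omega x -> laplacian v x - L * v x = f x,
      forall x, vertex_boundary Omega x -> v x = 0 &
      forall x, ~ (Omega `|` vertex_boundary Omega) x -> v x = 0].

(* [w] is the previous iterate, starting from 0. For finite [Omega] and [L > 0] the Dirichlet problem has exactly one
   solution, so the default value of [xget] is never used. *)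
Fixpoint iterate (R : realType) (n : nat) (G : R -> R) (h : lattice n -> R)
    (L : R) (Omega : set (lattice n)) (k : nat) : lattice n -> R :=
  if k is k'.+1 then
    let w := iterate G h L Omega k' in
    xget (fun=> 0)
      [set v | dirichlet_solution L Omega (fun x => G (w x) + h x - L * w x) v]
  else fun=> 0.

Definition u_dom (R : realType) (n : nat) (G : R -> R) (h : lattice n -> R)
    (L : R) (Omega : set (lattice n)) (x : lattice n) : R :=
  limn (fun k => iterate G h L Omega k x).

Definition u_lim (R : realType) (n : nat) (G : R -> R) (h : lattice n -> R)
    (L : R) (Omega : nat -> set (lattice n)) (x : lattice n) : R :=
  limn (fun i => u_dom G h L (Omega i) x).

(* Main.v *)
Require Import Defs.
From HB Require Import structures.
From mathcomp Require Import all_boot all_order all_algebra.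
From mathcomp Require Import finmap lra ring.
From mathcomp Require Import all_classical all_reals all_analysis.
Import Order.TTheory GRing.Theory Num.Theory.
Import numFieldNormedType.Exports.

(** Zero is a supersolution and any subsolution between [c] and [0] bounds the
    monotone iteration from below, uniformly in the domain; hence the limit
    function solves the equation and inherits the lower bound.  Take
    [c = s0 + delta]: then [g t <= kappa * t] on [[c, 0]] with
    [kappa = g c / c > 0], so for small [a] and large [K] the maximum of [c] and
    [- K * exp (- a d(x))] is a subsolution, which gives the bounds and the decay
    of [u] at once.  Since [lam1 (e^(A t) - 1) + lam2 (e^(- B t) - 1) <= g t],
    [u] is in turn a subsolution of the equation for [ubar], and the same
    iteration above [u] yields [u <= ubar <= 0].  Any rate below [m] is of the
    form [m * (1 - eps0)], so [a] may be taken as small as needed. *)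

Set Implicit Arguments.
Unset Strict Implicit.
Unset Printing Implicit Defensive.

Local Open Scope classical_set_scope.
Local Open Scope ring_scope.

(** * Lattice distance, unit steps and the graph Laplacian *)

Lemma dist0D n (x e : lattice n) : (dist x 0 <= dist (x + e) 0 + dist 0 e)%N.
Proof.
rewrite /dist -big_split; apply: leq_sum => i _.
rewrite !mxE !subr0 sub0r abszN -lez_nat PoszD !abszE.
by rewrite -{1}(addrK (e 0 i) (x 0 i)) ler_normB.
Qed.

Lemma adj_addl n (x e : lattice n) : adj x (x + e) = adj 0 e.
Proof.
rewrite /adj /dist; congr (_ == _); apply: eq_bigr => i _.
by rewrite !mxE opprD addrA subrr.
Qed.

Lemma finite_unit_steps n : finite_set [set e : lattice n | adj 0 e].
Proof.
(* Every coordinate of a unit step lies in {-1, 0, 1}; the code in ['I_3] is the coordinate plus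
   one. *)
apply: (@sub_finite_set _ _
  (range (fun f : {ffun 'I_n -> 'I_3} => \row_i ((f i : nat)%:Z - 1)))).
  move=> e /eqP e1.
  have le1 i : `|e 0 i| <= 1.
    have : (`|e 0%R i| <= 1)%N.
      rewrite -[X in (_ <= X)%N]e1 /dist (bigD1 i)//= !mxE sub0r abszN.
      exact: leq_addr.
    by rewrite -lez_nat abszE.
  have lt3 i : (`|(e 0 i + 1)%R| < 3)%N.
    rewrite ltnS -lez_nat abszE; apply: (le_trans (ler_normD _ _)).
    by rewrite normr1 -[2%:Z]/(1 + 1 :> int) lerD2r.
  exists [ffun i => Ordinal (lt3 i)] => //.
  apply/rowP => i; rewrite mxE ffunE /= abszE ger0_norm ?addrK//.
  by rewrite -(subrK 1 (0 : int)) lerD2r sub0r;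
    case/ler_normlP: (le1 i); rewrite lerNl.
by apply: finite_image; exact: finite_finset.
Qed.

Definition unit_steps n : seq (lattice n) :=
  enum_fset (fset_set [set e : lattice n | adj 0 e]).

Lemma mem_unit_steps n (e : lattice n) : (e \in unit_steps n) = adj 0 e.
Proof.
rewrite /unit_steps in_fset_set; last exact: finite_unit_steps.
by apply/idP/idP; rewrite inE.
Qed.

(** Translating the neighbours of [x] to the origin gives an index list independent of [x], so
    linearity, comparison and limits can be handled term by term. *)
Lemma laplacianE (R : realType) n (u : lattice n -> R) x :
  laplacian u x = \sum_(e <- unit_steps n) (u (x + e) - u x).
Proof.
rewrite /laplacian /unit_steps -fsbig_finite; last exact: finite_unit_steps.
apply: (@reindex_fsbig _ _ _ _ _ (fun e => x + e)); split.
- by move=> e /=; rewrite adj_addl.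
- by move=> e f _ _ /addrI.
- by move=> y /= xy; exists (y - x);
    rewrite /= ?(addrC x) ?subrK// -(adj_addl x) addrC subrK.
Qed.

Lemma laplacianB (R : realType) n (u v : lattice n -> R) x :
  laplacian (fun y => u y - v y) x = laplacian u x - laplacian v x.
Proof.
rewrite !laplacianE -sumrB; apply: eq_bigr => e _; ring.
Qed.

Lemma laplacianN (R : realType) n (u : lattice n -> R) x :
  laplacian (fun y => - u y) x = - laplacian u x.
Proof.
rewrite !laplacianE -sumrN; apply: eq_bigr => e _; ring.
Qed.

Lemma ler_laplacian (R : realType) n (u v : lattice n -> R) x :
  u x = v x -> (forall y, u y <= v y) -> laplacian u x <= laplacian v x.
Proof.
by move=> uv ule; rewrite !laplacianE; apply: ler_sum => e _; rewrite uv lerD2r.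
Qed.

Lemma laplacian_cst (R : realType) n (c : R) (x : lattice n) :
  laplacian (fun=> c) x = 0.
Proof. by rewrite laplacianE big1// => e _; rewrite subrr. Qed.

Lemma cvg_laplacian (R : realType) n (w : nat -> lattice n -> R)
    (u : lattice n -> R) x :
  (forall y, w k y @[k --> \oo] --> u y) ->
  laplacian (w k) x @[k --> \oo] --> laplacian u x.
Proof.
move=> wu; rewrite laplacianE.
under eq_fun do rewrite laplacianE.
apply: cvg_big => [|e _]; last exact: cvgB.
exact: add_continuous.
Qed.

(** * Maximum principle and the Dirichlet problem on finite sets *)

(** If [w] were positive somewhere, its maximum over [Omega] would be a global one, since [w <= 0]
    outside. There the Laplacian is nonpositive and [- L * w] is negative, a contradiction. *)
Lemma maximum_principle (R : realType) n (Omega : set (lattice n)) (L : R)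
    (w : lattice n -> R) :
  finite_set Omega -> 0 < L ->
  (forall x, Omega x -> 0 <= laplacian w x - L * w x) ->
  (forall x, ~ Omega x -> w x <= 0) ->
  forall x, w x <= 0.
Proof.
move=> fO L0 wO wout x; have [Ox|] := pselect (Omega x); last exact: wout.
have xO : x \in fset_set Omega by rewrite in_fset_set// inE.
rewrite leNgt; apply/negP => wx0.
have [z _ zmax] := @arg_maxP _ _ (fset_set Omega) [` xO]%fset xpredT
  (fun y => w (val y)) isT.
have wmax y : w y <= w (val z).
  have [Oy|/wout wy] := pselect (Omega y).
    have yO : y \in fset_set Omega by rewrite in_fset_set// inE.
    exact: (zmax [` yO]%fset).
  by apply: (le_trans wy); apply: (le_trans (ltW wx0)); exact: (zmax [` xO]%fset).
have Oz : Omega (val z) by have := valP z; rewrite in_fset_set// inE.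
have wz0 : 0 < w (val z) by apply: (lt_le_trans wx0); exact: (zmax [` xO]%fset).
have := wO _ Oz; apply/negP; rewrite -ltNge subr_lt0.
apply: (@le_lt_trans _ _ 0); last exact: mulr_gt0.
by rewrite laplacianE; apply: sumr_le0 => e _; rewrite subr_le0.
Qed.

Lemma dirichlet_solution_out (R : realType) n (Omega : set (lattice n)) (L : R)
    f v x : dirichlet_solution L Omega f v -> ~ Omega x -> v x = 0.
Proof.
case=> _ vb vout nOx; have [|nbx] := pselect (vertex_boundary Omega x).
  exact: vb.
by apply: vout => -[].
Qed.

(** The problem is a square linear system indexed by the points of [Omega]; the maximum principle
    makes it injective, hence solvable. *)
Lemma dirichlet_solution_exists (R : realType) n (Omega : set (lattice n))
    (L : R) f :
  finite_set Omega -> 0 < L -> exists v, dirichlet_solution L Omega f v.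
Proof.
move=> fO L0; pose s := enum_fset (fset_set Omega).
have sO x : (x \in s) <-> Omega x.
  rewrite [x \in s]in_fset_set//; split; last by move=> Ox; rewrite inE.
  by rewrite inE.
have us : uniq s by exact: fset_uniq.
pose pt (i : 'I_(size s)) := tnth (in_tuple s) i.
have ptO i : Omega (pt i) by apply/sO; exact: mem_tnth.
have ptx x : Omega x -> exists i, x = pt i.
  by move=> /sO xs; apply/(tnthP (in_tuple s)).
have ptI : injective pt by apply/tuple_uniqP.
pose ext (v : 'rV[R]_(size s)) x := \sum_i v 0 i * (x == pt i)%:R.
have ext_pt v i : ext v (pt i) = v 0 i.
  rewrite /ext (bigD1 i)//= eqxx mulr1 big1 ?addr0// => j ji.
  by rewrite (inj_eq ptI) eq_sym (negbTE ji) mulr0.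
have ext_out v x : ~ Omega x -> ext v x = 0.
  move=> nOx; rewrite /ext big1// => i _.
  by case: eqP => [xi|_]; [case: nOx; rewrite xi|rewrite mulr0].
pose op (u : lattice n -> R) x := laplacian u x - L * u x.
(* Row [j] holds the operator applied to the indicator of [pt j], so a row vector acts from the left
   through its zero extension [ext]. *)
pose A : 'M[R]_(size s) := \matrix_(j, i) op (fun x => (x == pt j)%:R) (pt i).
have opE v i : (v *m A) 0 i = op (ext v) (pt i).
  rewrite mxE /op laplacianE [in RHS]/ext mulr_sumr.
  under [X in _ = X - _]eq_bigr do rewrite -sumrB.
  rewrite exchange_big -sumrB; apply: eq_bigr => j _ /=.
  rewrite mxE /op laplacianE mulrBr mulr_sumr mulrCA; congr (_ - _).
  by apply: eq_bigr => e _; rewrite mulrBr.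
have ext_le0 v : v *m A = 0 -> forall x, ext v x <= 0.
  move=> vA; apply: (maximum_principle fO L0) => x; last by move/ext_out ->.
  by move=> /ptx[i ->]; rewrite -/(op _ _) -opE vA mxE.
(* The sign bound for a kernel vector, applied to [v] and to [- v], forces [v = 0]. *)
have Aunit : A \in unitmx.
  rewrite -row_free_unit -kermx_eq0; apply/rowV0P => v /sub_kermxP vA.
  apply/rowP => i; rewrite mxE; apply/eqP; rewrite eq_le -{1}ext_pt ext_le0//=.
  have := @ext_le0 (- v) _ (pt i); rewrite ext_pt mxE oppr_le0; apply.
  by rewrite mulNmx vA oppr0.
pose b : 'rV[R]_(size s) := \row_i f (pt i).
exists (ext (b *m invmx A)); split.
- by move=> _ /ptx[i ->]; rewrite -/(op _ _) -opE mulmxKV// mxE.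
- by move=> x [nOx _]; exact: ext_out.
- by move=> x nOx; apply: ext_out => Ox; apply: nOx; left.
Qed.

(** * Monotone iteration between a subsolution and zero *)

(** Everything the iteration requires of the nonlinearity, the source and the lower bound, stated
    abstractly because it is instantiated twice: for [g] with a barrier and for [g_bar] with [u]. *)
Record is_subsolution (R : realType) n (G : R -> R) (h : lattice n -> R)
    (L c : R) (psi : lattice n -> R) : Prop := IsSubsolution {
  damping_gt0 : 0 < L;
  nonlinearity_continuous : continuous G;
  zero_supersolution : forall x, 0 <= G 0 + h x;
  damped_antitone : forall s t, c <= s -> s <= t -> t <= 0 ->
    G t - L * t <= G s - L * s;
  subsolution_range : forall x, c <= psi x <= 0;
  subsolution_ineq : forall x, G (psi x) + h x <= laplacian psi x }.

Lemma iterateS (R : realType) n (G : R -> R) (h : lattice n -> R) L Omega k :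
  finite_set Omega -> 0 < L ->
  let w := iterate G h L Omega k in
  dirichlet_solution L Omega (fun x => G (w x) + h x - L * w x)
    (iterate G h L Omega k.+1).
Proof.
move=> fO L0 w; apply: (@xgetPex _ _ [set v | dirichlet_solution L Omega _ v]).
exact: dirichlet_solution_exists.
Qed.

Lemma iterate_out (R : realType) n (G : R -> R) (h : lattice n -> R) L Omega k x :
  finite_set Omega -> 0 < L -> ~ Omega x -> iterate G h L Omega k x = 0.
Proof.
move=> fO L0; case: k => [//|k].
exact: (dirichlet_solution_out (iterateS _ _ _ fO L0)).
Qed.

(** Bounds and monotonicity in [k] go through one induction: antitonicity of [G t - L * t] is known
    only on [[c, 0]], so the order of consecutive iterates can be propagated only while both are
    known to lie there. *)
Lemma iterate_bounds (R : realType) n (G : R -> R) (h : lattice n -> R) L c psi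
    Omega k x :
  finite_set Omega -> is_subsolution G h L c psi ->
  psi x <= iterate G h L Omega k x <= 0
  /\ iterate G h L Omega k.+1 x <= iterate G h L Omega k x.
Proof.
move=> fO [L0 _ G0 Ganti psic psisub].
have out k' y := @iterate_out _ _ G h L Omega k' y fO L0.
have eqn k' y Oy := let: And3 e _ _ := iterateS G h k' fO L0 in e y Oy.
elim: k x => [|k IH] x.
  split; first by rewrite lexx andbT; case/andP: (psic x).
  (* Starting from zero, the first right-hand side is [G 0 + h], nonnegative because zero is a
     supersolution. *)
  apply: (maximum_principle fO L0) => y; last by move=> /out ->.
  by move=> Oy; rewrite (eqn 0%N)//= mulr0 subr0.
set w := iterate G h L Omega in out eqn IH *.
have wc y : c <= w k y.
  by have [/andP[+ _] _] := IH y; apply: le_trans; case/andP: (psic y).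
have le0 y : w k.+1 y <= 0.
  by have [/andP[_ w0] ww] := IH y; exact: le_trans w0.
(* The maximum principle for [psi - w k.+1], with antitonicity applied to [psi y <= w k y]. *)
have psile y : psi y <= w k.+1 y.
  rewrite -subr_le0; move: y.
  apply: (maximum_principle fO L0) => y; last first.
    by move=> /out ->; rewrite subr0; case/andP: (psic y).
  move=> Oy; rewrite laplacianB.
  have /andP[psiy _] := psic y.
  have [/andP[pw w0] _] := IH y.
  have := Ganti _ _ psiy pw w0; have := psisub y; have := eqn k y Oy.
  rewrite -/w; lra.
split; first by rewrite psile le0.
rewrite -subr_le0; move: x; apply: (maximum_principle fO L0) => y; last first.
  by move=> Oy; rewrite !out// subr0.
move=> Oy; rewrite laplacianB.
have [/andP[pw w0] ww] := IH y.
have cw1 : c <= w k.+1 y.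
  by apply: le_trans (psile y); case/andP: (psic y).
have := Ganti _ _ cw1 ww w0; have := eqn k.+1 y Oy; have := eqn k y Oy.
rewrite -/w; lra.
Qed.

(** The two iterates are compared on the smaller set: outside it the smaller-domain iterate is zero
    and the other one is nonpositive. *)
Lemma iterate_domain_antitone (R : realType) n (G : R -> R) (h : lattice n -> R)
    L c psi (Omega Omega' : set (lattice n)) k x :
  finite_set Omega -> finite_set Omega' -> Omega `<=` Omega' ->
  is_subsolution G h L c psi ->
  iterate G h L Omega' k x <= iterate G h L Omega k x.
Proof.
move=> fO fO' sub S; have [L0 _ G0 Ganti psic psisub] := S.
have bnd k' y := iterate_bounds k' y fO S.
have bnd' k' y := iterate_bounds k' y fO' S.
have eqn k' y Oy := let: And3 e _ _ := iterateS G h k' fO L0 in e y Oy.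
have eqn' k' y Oy := let: And3 e _ _ := iterateS G h k' fO' L0 in e y Oy.
elim: k x => [//|k IH] x; rewrite -subr_le0; move: x.
apply: (maximum_principle fO L0) => x Ox; last first.
  rewrite (iterate_out _ _ _ fO L0)// subr0.
  by have [/andP[]] := bnd' k.+1 x.
rewrite laplacianB.
have [/andP[pw _] _] := bnd' k x.
have [/andP[_ w0] _] := bnd k x.
have cw' : c <= iterate G h L Omega' k x.
  by apply: le_trans pw; case/andP: (psic x).
have := Ganti _ _ cw' (IH x) w0.
have := eqn k x Ox; have := eqn' k x (sub _ Ox); lra.
Qed.

Lemma nonincreasing_cvg_limn (R : realType) (a : nat -> R) (c : R) :
  (forall k, a k.+1 <= a k) -> (forall k, c <= a k) ->
  a k @[k --> \oo] --> limn a.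
Proof.
move=> /nonincreasing_seqP amono ca; apply: nonincreasing_is_cvgn => //.
by exists c => _ [k _ <-].
Qed.

Lemma limn_between (R : realType) (a : nat -> R) (c b : R) :
  a k @[k --> \oo] --> limn a -> (forall k, c <= a k <= b) -> c <= limn a <= b.
Proof.
move=> acvg ab; apply/andP; split.
  by apply: limr_ge => //; apply: nearW => k; case/andP: (ab k).
by apply: limr_le => //; apply: nearW => k; case/andP: (ab k).
Qed.

(** * Passage to the limit in the iteration and in the exhaustion *)

Section Limits.
Context (R : realType) (n : nat) (G : R -> R) (h : lattice n -> R) (L c : R).
Context (psi : lattice n -> R) (S : is_subsolution G h L c psi).
Implicit Types Omega : set (lattice n).

Lemma iterate_cvg_u_dom Omega x : finite_set Omega ->
  iterate G h L Omega k x @[k --> \oo] --> u_dom G h L Omega x.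
Proof.
move=> fO; apply: (@nonincreasing_cvg_limn _ _ (psi x)) => k.
  by case: (iterate_bounds k x fO S).
by case: (iterate_bounds k x fO S) => /andP[].
Qed.

Lemma u_dom_bounds Omega x : finite_set Omega ->
  psi x <= u_dom G h L Omega x <= 0.
Proof.
move=> fO; apply: limn_between; first exact: iterate_cvg_u_dom.
by move=> k; case: (iterate_bounds k x fO S).
Qed.

Lemma u_dom_eq Omega x : finite_set Omega -> Omega x ->
  laplacian (u_dom G h L Omega) x = G (u_dom G h L Omega x) + h x.
Proof.
move=> fO Ox; have [L0 Gc _ _ _ _] := S.
set w := iterate G h L Omega; set u := u_dom G h L Omega.
have wu y : w k y @[k --> \oo] --> u y by exact: iterate_cvg_u_dom.
have wSu y : w k.+1 y @[k --> \oo] --> u y.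
  by rewrite (@cvg_shiftS _ (fun k => w k y) _).
have lhs : laplacian (w k.+1) x - L * w k.+1 x @[k --> \oo] -->
    laplacian u x - L * u x.
  apply: cvgB; last by apply: cvgM => //; exact: cvg_cst.
  exact: (@cvg_laplacian _ _ (fun k => w k.+1)).
have rhs : G (w k x) + h x - L * w k x @[k --> \oo] --> G (u x) + h x - L * u x.
  apply: cvgB; last by apply: cvgM => //; exact: cvg_cst.
  apply: cvgD; last exact: cvg_cst.
  exact: (continuous_cvg _ (Gc (u x)) (wu x)).
(* The scheme couples iterates [k.+1] and [k], which share their limit, so the damping terms cancel
   once both sides have converged. *)
have E : (fun k => laplacian (w k.+1) x - L * w k.+1 x) =
         (fun k => G (w k x) + h x - L * w k x).
  by apply/funext => k; case: (iterateS G h k fO L0) => + _ _; apply.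
rewrite E in lhs; apply: (@addIr _ (- (L * u x))); apply: (cvg_unique _ lhs rhs).
exact: norm_hausdorff.
Qed.

Lemma u_dom_antitone Omega Omega' x : finite_set Omega -> finite_set Omega' ->
  Omega `<=` Omega' -> u_dom G h L Omega' x <= u_dom G h L Omega x.
Proof.
move=> fO fO' sub; apply: ler_lim.
- by apply/cvg_ex; eexists; exact: iterate_cvg_u_dom.
- by apply/cvg_ex; eexists; exact: iterate_cvg_u_dom.
- by apply: nearW => k; apply: iterate_domain_antitone S.
Qed.

Context (Omega : nat -> set (lattice n)).
Context (fO : forall i, finite_set (Omega i)).
Context (Omono : forall i, Omega i `<=` Omega i.+1).

Lemma u_dom_cvg_u_lim x :
  u_dom G h L (Omega i) x @[i --> \oo] --> u_lim G h L Omega x.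
Proof.
apply: (@nonincreasing_cvg_limn _ _ (psi x)) => i; first exact: u_dom_antitone.
by case/andP: (u_dom_bounds x (fO i)).
Qed.

Lemma u_lim_bounds x : psi x <= u_lim G h L Omega x <= 0.
Proof.
apply: limn_between; first exact: u_dom_cvg_u_lim.
by move=> i; exact: u_dom_bounds.
Qed.

Lemma u_lim_eq x : \bigcup_i Omega i = setT ->
  laplacian (u_lim G h L Omega) x = G (u_lim G h L Omega x) + h x.
Proof.
move=> cover; have [_ Gc _ _ _ _] := S.
have [i0 _ Ox] : (\bigcup_i Omega i) x by rewrite cover.
have Oi i : (i0 <= i)%N -> Omega i x.
  by elim: i => [|i IH]; [rewrite leqn0 => /eqP <-
    |rewrite leq_eqVlt => /predU1P[<- //|/IH/Omono]].
set u := u_lim G h L Omega.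
have wu y : u_dom G h L (Omega i) y @[i --> \oo] --> u y.
  exact: u_dom_cvg_u_lim.
have lhs : laplacian (u_dom G h L (Omega i)) x @[i --> \oo] --> laplacian u x.
  exact: (@cvg_laplacian _ _ (fun i => u_dom G h L (Omega i))).
have rhs : G (u_dom G h L (Omega i) x) + h x @[i --> \oo] --> G (u x) + h x.
  apply: cvgD; last exact: cvg_cst.
  exact: (continuous_cvg _ (Gc (u x)) (wu x)).
apply: (cvg_unique _ lhs); first exact: norm_hausdorff.
(* The equation at [x] holds only for the sets that contain [x], that is from [i0] on. *)
apply: cvg_trans rhs; apply: near_eq_cvg; exists i0 => // i /= /Oi Oix.
by rewrite u_dom_eq.
Qed.

End Limits.

(** * Exponential barriers *)

Definition barrier (R : realType) n (c : R) (V : lattice n -> R) y : R :=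
  Num.max c (- V y).

(** A maximum of two subsolutions is a subsolution: at each point it touches from above whichever of
    [c] and [- V] attains it, so its Laplacian there is at least as large. The cut at [c] keeps the
    values where the linear bound on [G] is available. *)
Lemma barrier_subsolution (R : realType) n (G : R -> R) (h : lattice n -> R)
    (c kappa : R) (V : lattice n -> R) x :
  (forall t, c <= t -> t <= 0 -> G t <= kappa * t) ->
  G c + h x <= 0 -> 0 <= V x -> laplacian V x <= kappa * V x - h x ->
  G (barrier c V x) + h x <= laplacian (barrier c V) x.
Proof.
move=> Gk Gc V0 lapV; set psi := barrier c V.
have psic y : c <= psi y by rewrite le_max lexx.
have psiV y : - V y <= psi y by rewrite le_max lexx orbT.
have [psix|psix] : psi x = c \/ psi x = - V x.
  by rewrite /psi /barrier; case: leP => _; [right|left].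
- apply: (@le_trans _ _ (laplacian (fun=> c) x)).
    by rewrite laplacian_cst psix.
  by apply: ler_laplacian; rewrite ?psix.
- apply: (@le_trans _ _ (laplacian (fun y => - V y) x)); last first.
    by apply: ler_laplacian; rewrite ?psix.
  have psi0 : psi x <= 0 by rewrite psix oppr_le0.
  have := Gk _ (psic x) psi0; rewrite laplacianN psix; lra.
Qed.

(** A unit step lowers the distance to the origin by at most one, so each neighbour's value is at
    most [expR a] times the value at [x]. *)
Lemma laplacian_expR_dist (R : realType) n (a : R) (x : lattice n) : 0 <= a ->
  laplacian (fun y => expR (- a * (dist y 0)%:R)) x
  <= (size (unit_steps n))%:R * (expR a - 1) * expR (- a * (dist x 0)%:R).
Proof.
move=> a0; rewrite laplacianE -mulrA -sum1_size natr_sum mulr_suml.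
rewrite big_seq [leRHS]big_seq; apply: ler_sum => e.
rewrite mem_unit_steps => /eqP e1.
rewrite mul1r mulrBl mul1r lerD2r -expRD ler_expR.
have := dist0D x e; rewrite e1 -(ler_nat R) natrD => d1.
have := ler_wpM2l a0 d1; rewrite mulrDr mulr1 !mulNr; lra.
Qed.

(** * Chord bound and continuity of the nonlinearity *)

(** Convexity of the exponential between 0 and [y], from the tangent line at [z = theta * y]
    evaluated at both ends and averaged with weights [1 - theta] and [theta]. *)
Lemma expR_chord (R : realType) (theta y : R) : 0 <= theta <= 1 ->
  expR (theta * y) - 1 <= theta * (expR y - 1).
Proof.
move=> /andP[t0 t1]; set z := theta * y.
have ez : 0 < expR z by exact: expR_gt0.
have e0 : expR z * (1 - z) <= 1.
  rewrite -[X in _ <= X](@expRxMexpNx_1 _ z) ler_pM2l//; exact: expR_ge1Dx.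
have ey : expR z * (1 + (y - z)) <= expR y.
  by rewrite -[in leRHS](subrK z y) (addrC (y - z)) expRD ler_pM2l// expR_ge1Dx.
have t1' : 0 <= 1 - theta by rewrite subr_ge0.
have E : theta * (expR z * (1 + (y - z))) + (1 - theta) * (expR z * (1 - z))
    = expR z.
  have -> : theta * (expR z * (1 + (y - z))) + (1 - theta) * (expR z * (1 - z))
    = expR z * (1 + theta * y - z) by ring.
  by rewrite -/z addrK mulr1.
have := ler_wpM2l t0 ey; have := ler_wpM2l t1' e0; lra.
Qed.

(* [g t = expR (A t) * r t] with [r] convex on the negative half-line and
   [r 0 = 0], although [g] itself need not be convex there. *)
Lemma g_chord (R : realType) (lam1 lam2 A B c t : R) :
  0 < lam1 -> 0 < lam2 -> 0 < A -> 0 < B -> c < 0 -> g lam1 lam2 A B c <= 0 ->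
  c <= t -> t <= 0 ->
  g lam1 lam2 A B t <= g lam1 lam2 A B c / c * t.
Proof.
move=> l1 l2 A0 B0 c0 gc ct t0.
pose q s := expR (- (A + B) * s).
pose r s := lam1 * (expR (A * s) - 1) + lam2 * (q s * (expR (- B * s) - 1)).
have gE s : g lam1 lam2 A B s = expR (A * s) * r s.
  have -> : g lam1 lam2 A B s = lam1 * expR (A * s) * (expR (A * s) - 1)
    + lam2 * (expR (A * s) * q s) * (expR (- B * s) - 1).
    by rewrite /g /q -expRD; congr (_ + _ * expR _ * _); ring.
  rewrite /r; ring.
pose theta := t / c.
have tE : t = theta * c by rewrite /theta divfK// lt_eqF.
have th01 : 0 <= theta <= 1.
  by rewrite /theta ler_ndivlMr// mul0r t0 ler_ndivrMr// mul1r.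
have /andP[th0 th1] := th01.
have rc : r c <= 0 by move: gc; rewrite gE pmulr_rle0// expR_gt0.
have rt : r t <= theta * r c.
  have h1 : expR (A * t) - 1 <= theta * (expR (A * c) - 1).
    by rewrite tE mulrCA; exact: expR_chord.
  have h2 : expR (- B * t) - 1 <= theta * (expR (- B * c) - 1).
    by rewrite tE mulrCA; exact: expR_chord.
  have h6 : q t <= q c by rewrite ler_expR !mulNr lerN2 ler_pM2l// addr_gt0.
  have h4 : 0 <= expR (- B * t) - 1.
    by rewrite subr_ge0 -expR0 ler_expR mulNr -mulrN mulr_ge0 ?oppr_ge0// ltW.
  (* Both factors are nonnegative; [q] is decreasing and the second factor obeys the chord bound. *)
  have h5 : q t * (expR (- B * t) - 1) <= q c * (theta * (expR (- B * c) - 1)).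
    by apply: ler_pM => //; exact: expR_ge0.
  rewrite /r [leRHS]mulrDr; apply: lerD.
    by rewrite mulrCA ler_pM2l.
  by rewrite [leRHS]mulrCA ler_pM2l// [leRHS]mulrCA.
have -> : g lam1 lam2 A B c / c * t = expR (A * c) * (theta * r c).
  by rewrite gE /theta; ring.
rewrite gE; apply: (@le_trans _ _ (expR (A * t) * (theta * r c))).
  by rewrite ler_pM2l ?expR_gt0.
(* Since [theta * r c] is nonpositive, replacing [expR (A * t)] by the smaller [expR (A * c)] can
   only raise the product. *)
apply: ler_wnM2r; first exact: mulr_ge0_le0.
by rewrite ler_expR ler_pM2l.
Qed.

Lemma continuous_expRM (R : realType) (a : R) : continuous (fun t => expR (a * t)).
Proof.
move=> t; apply: continuous_comp; last exact: continuous_expR.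
exact: mulrl_continuous.
Qed.

Lemma continuous_expRMB1 (R : realType) (a : R) :
  continuous (fun t => expR (a * t) - 1).
Proof.
by move=> t; apply: cvgB; [exact: continuous_expRM|exact: cvg_cst].
Qed.

Lemma continuous_g (R : realType) (lam1 lam2 A B : R) :
  continuous (g lam1 lam2 A B).
Proof.
move=> t; apply: cvgD; (apply: cvgM; last exact: continuous_expRMB1);
  by apply: cvgM; [exact: cvg_cst|exact: continuous_expRM].
Qed.

(** * The nonlinearity of the second equation *)

Definition g_bar (R : realType) (lam1 lam2 A B t : R) : R :=
  lam1 * (expR (A * t) - 1) + lam2 * (expR (- B * t) - 1).

Lemma continuous_g_bar (R : realType) (lam1 lam2 A B : R) :
  continuous (g_bar lam1 lam2 A B).
Proof.
by move=> t; apply: cvgD; (apply: cvgM; [exact: cvg_cst|exact: continuous_expRMB1]).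
Qed.

(** The difference is a positive combination of two squares. *)
Lemma g_bar_le_g (R : realType) (lam1 lam2 A B t : R) : 0 < lam1 -> 0 < lam2 ->
  g_bar lam1 lam2 A B t <= g lam1 lam2 A B t.
Proof.
move=> l1 l2; rewrite -subr_ge0.
have -> : g lam1 lam2 A B t - g_bar lam1 lam2 A B t =
  lam1 * (expR (A * t) - 1) ^+ 2 + lam2 * (expR (- B * t) - 1) ^+ 2.
  by rewrite /g /g_bar; ring.
by apply: addr_ge0; apply: mulr_ge0; rewrite ?sqr_ge0// ltW.
Qed.

(** On the negative half-line the increasing term has slope at most [lam1 * A] and the other term
    decreases, so [lam1 * A] serves as damping constant in the second iteration. *)
Lemma g_bar_damped_antitone (R : realType) (lam1 lam2 A B s t : R) :
  0 < lam1 -> 0 < lam2 -> 0 < A -> 0 < B -> s <= t -> t <= 0 ->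
  g_bar lam1 lam2 A B t - lam1 * A * t <= g_bar lam1 lam2 A B s - lam1 * A * s.
Proof.
move=> l1 l2 A0 B0 st t0.
have hB : expR (- B * t) <= expR (- B * s).
  by rewrite ler_expR !mulNr lerN2 ler_pM2l.
have hA : expR (A * t) - expR (A * s) <= A * (t - s).
  have et : expR (A * t) <= 1 by rewrite -expR0 ler_expR pmulr_rle0.
  have es : expR (A * t) * (1 + A * (s - t)) <= expR (A * s).
    have -> : A * s = A * t + A * (s - t) by ring.
    by rewrite expRD ler_pM2l ?expR_gt0// expR_ge1Dx.
  have d0 : 0 <= A * (t - s) by rewrite mulr_ge0 ?subr_ge0// ltW.
  have := ler_wpM2r d0 et; move: es; nra.
have := ler_wpM2l (ltW l1) hA; have := ler_wpM2l (ltW l2) hB; rewrite /g_bar; lra.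
Qed.

(** * Size and decay of the source *)

Lemma h3_ge0 (R : realType) n M (p : 'I_M -> lattice n) (mult : 'I_M -> R) x :
  (forall j, 0 < mult j) -> 0 <= h3 p mult x.
Proof.
move=> mult0; rewrite /h3 mulr_ge0// ?mulr_ge0 ?pi_ge0//.
by apply: sumr_ge0 => j _; rewrite mulr_ge0// ltW.
Qed.

Lemma h3_le_max (R : realType) n M (p : 'I_M -> lattice n) (mult : 'I_M -> R) x :
  injective p ->
  h3 p mult x <= 4 * pi * \big[Num.max/0]_(j < M) mult j.
Proof.
move=> pI; rewrite /h3 ler_wpM2l ?mulr_ge0 ?pi_ge0//.
have [[j xj]|nx] := pselect (exists j, x = p j).
  rewrite (bigD1 j)//= big1 ?addr0; first by rewrite xj eqxx mulr1 le_bigmax.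
  by move=> i ij; rewrite xj (inj_eq pI) eq_sym (negbTE ij) mulr0.
rewrite big1; first exact: bigmax_ge_id.
by move=> j _; case: eqP => [xj|_]; [case: nx; exists j|rewrite mulr0].
Qed.

(** The weight [expR (a * d(p j))] cancels the exponential exactly at [x = p j]; elsewhere the term
    on the left vanishes. *)
Lemma h3_decay (R : realType) n M (p : 'I_M -> lattice n) (mult : 'I_M -> R)
    (a : R) x : (forall j, 0 < mult j) ->
  h3 p mult x <= (4 * pi * \sum_(j < M) mult j * expR (a * (dist (p j) 0)%:R))
    * expR (- a * (dist x 0)%:R).
Proof.
move=> mult0; rewrite /h3 -[leRHS]mulrA ler_wpM2l ?mulr_ge0 ?pi_ge0//.
rewrite mulr_suml; apply: ler_sum => j _.
rewrite -[leRHS]mulrA ler_wpM2l ?(ltW (mult0 j))//.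
rewrite -expRD mulNr; case: eqP => [->|_]; last exact: expR_ge0.
by rewrite subrr expR0.
Qed.

(** * Existence, ordering and decay of the two solutions *)

Theorem theorem1p4 (R : realType) (n : nat) (hn : (2 <= n)%N)
    (lam1 lam2 A B : R)
    (hlam1 : 0 < lam1) (hlam2 : 0 < lam2) (hA : 0 < A) (hB : 0 < B)
    (hAB : 0 < lam1 * A - lam2 * B)
    (M : nat) (hM : (1 <= M)%N)
    (p : 'I_M -> lattice n) (hp : injective p)
    (mult : 'I_M -> R) (hmult : forall j, 0 < mult j)
    (s0 : R) (hs0 : s0 < 0) (hgs0 : g lam1 lam2 A B s0 = 0)
    (delta : R) (hdelta : 0 < delta < - s0)
    (hmax : 4 * pi * (\big[Num.max/0]_(j < M) mult j)
            <= - g lam1 lam2 A B (s0 + delta))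
    (L : R) (hL : 0 < L)
    (hLdecr : forall s t : R, s0 + delta <= s -> s <= t -> t <= 0 ->
       g lam1 lam2 A B t - L * t <= g lam1 lam2 A B s - L * s)
    (Omega : nat -> set (lattice n))
    (hOfin : forall i, finite_set (Omega i))
    (hOconn : forall i, graph_connected (Omega i))
    (hOmono : forall i, Omega i `<=` Omega i.+1)
    (hOp : forall j, Omega 0%N (p j))
    (hOcover : \bigcup_i Omega i = setT) :
  let h := h3 p mult in
  let u := u_lim (g lam1 lam2 A B) h L Omega in
  let m := ln (1 + (lam1 * A - lam2 * B) / (2 * n%:R)) in
  [/\ forall x, s0 + delta <= u x <= 0,
      forall x, - laplacian u x
                + lam1 * expR (A * u x) * (expR (A * u x) - 1)
                + lam2 * expR (- B * u x) * (expR (- B * u x) - 1)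
                + h x = 0 &
      exists ubar : lattice n -> R,
        [/\ forall x, - laplacian ubar x
                      + lam1 * (expR (A * ubar x) - 1)
                      + lam2 * (expR (- B * ubar x) - 1)
                      + h x = 0,
            forall x, u x <= ubar x <= 0 &
            exists eps0 : R,
              [/\ 0 < eps0 < 1,
                  exp_decay (m * (1 - eps0)) u &
                  exp_decay (m * (1 - eps0)) ubar]]].
Proof.
pose G := g lam1 lam2 A B; move=> h u m.
pose c := s0 + delta; pose F := g_bar lam1 lam2 A B.
have pi4 : 0 < 4 * pi :> R by rewrite mulr_gt0 ?pi_gt0.
have c0 : c < 0 by case/andP: hdelta => _; rewrite /c; lra.
have hpos x : 0 <= h x by exact: h3_ge0.
have Gch x : G c + h x <= 0.
  by rewrite -lerBrDl sub0r; apply: le_trans hmax; exact: h3_le_max.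
have Gc : G c < 0.
  rewrite -oppr_gt0; apply: lt_le_trans hmax; apply: mulr_gt0 => //.
  exact: (lt_le_trans (hmult (Ordinal hM)) (le_bigmax _ _ _)).
pose kappa := G c / c.
have k0 : 0 < kappa by rewrite /kappa ltr_ndivlMr// mul0r.
have Gk t : c <= t -> t <= 0 -> G t <= kappa * t.
  by move=> ct t0; apply: g_chord => //; exact: ltW.
have G0 : G 0 = 0 by rewrite /G /g !mulr0 expR0 subrr !mulr0 addr0.
have F0 : F 0 = 0 by rewrite /F /g_bar !mulr0 expR0 subrr !mulr0 addr0.
have m0 : 0 < m.
  by rewrite ln_gt0// ltrDl divr_gt0// mulr_gt0// ltr0n (leq_trans _ hn).
pose D : R := (size (unit_steps n))%:R.
have D0 : 0 <= D by exact: ler0n.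
(* Chosen so that [D * q <= kappa / 2]; the [+ 1] keeps the denominator positive. *)
pose q := kappa / (2 * (D + 1)).
have q0 : 0 < q by rewrite divr_gt0// mulr_gt0// ltr_wpDl.
(* The first entry gives [a < m], hence a positive [eps0]; the second gives [expR a - 1 <= q]. *)
pose a := Num.min (m / 2) (ln (1 + q)).
have a0 : 0 < a by rewrite lt_min divr_gt0//= ln_gt0// ltrDl.
have am : a < m.
  apply: (@le_lt_trans _ _ (m / 2)); first by rewrite ge_min lexx.
  by rewrite ltr_pdivrMr// ltr_pMr// ltr1n.
have Da : D * (expR a - 1) <= kappa / 2.
  have ea : expR a - 1 <= q.
    rewrite lerBlDl -[leRHS]lnK ?posrE ?addr_gt0// ler_expR.
    by rewrite ge_min lexx orbT.
  apply: (le_trans (ler_wpM2l D0 ea)).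
  have : (D + 1) * q = kappa / 2.
    by rewrite /q; field; rewrite gt_eqF// ltr_wpDl.
  by move=> <-; rewrite ler_pM2r// lerDl.
pose H := 4 * pi * \sum_(j < M) mult j * expR (a * (dist (p j) 0)%:R).
have H0 : 0 <= H.
  rewrite mulr_ge0 ?(ltW pi4)//; apply: sumr_ge0 => j _.
  by rewrite mulr_ge0 ?expR_ge0// ltW.
pose E (x : lattice n) := expR (- a * (dist x 0)%:R).
(* With this [K], half of [kappa * V] equals [H * E], which dominates [h]; the other half dominates
   the Laplacian of [V]. *)
pose K := 2 * H / kappa; pose V x := K * E x.
have K0 : 0 <= K by rewrite /K mulr_ge0 ?invr_ge0 ?(ltW k0)// mulr_ge0.
have V0 x : 0 <= V x by rewrite mulr_ge0 ?expR_ge0.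
have lapV x : laplacian V x <= kappa * V x - h x.
  have -> : laplacian V x = K * laplacian E x.
    by rewrite !laplacianE mulr_sumr; apply: eq_bigr => e _; rewrite mulrBr.
  have lapE : laplacian E x <= kappa / 2 * E x.
    apply: (le_trans (laplacian_expR_dist x (ltW a0))).
    by rewrite ler_wpM2r ?expR_ge0.
  have hH : h x <= H * E x by exact: h3_decay.
  have KH : K * (kappa / 2 * E x) = H * E x.
    by rewrite /K; field; rewrite gt_eqF.
  have := ler_wpM2l K0 lapE; rewrite KH => lapKE.
  have -> : kappa * V x = H * E x + H * E x by rewrite -KH /V; field.
  lra.
have Su : is_subsolution G h L c (barrier c V).
  split=> //; first exact: continuous_g.
  - by move=> x; rewrite G0 add0r.
  - by move=> x; rewrite le_max lexx/= ge_max (ltW c0) oppr_le0 V0.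
  - by move=> x; exact: (barrier_subsolution Gk).
have uV x : barrier c V x <= u x <= 0 by exact: (u_lim_bounds Su).
have uc x : c <= u x <= 0.
  case/andP: (uV x) => + ->; rewrite andbT; apply: le_trans.
  by rewrite le_max lexx.
have ueq x : laplacian u x = G (u x) + h x by exact: (u_lim_eq Su).
have Sb : is_subsolution F h (lam1 * A) c u.
  split=> //.
  - exact: mulr_gt0.
  - exact: continuous_g_bar.
  - by move=> x; rewrite F0 add0r.
  - by move=> s t _; exact: g_bar_damped_antitone.
  - by move=> x; rewrite ueq lerD2r; exact: g_bar_le_g.
(* For [eps0 = 1 - a / m] the rate [m * (1 - eps0)] is [a], and any [v] between [u] and zero
   satisfies [- V <= v <= 0]. *)
have decay v : (forall x, u x <= v x <= 0) -> exp_decay (m * (1 - (1 - a / m))) v.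
  move=> uv; exists K => x; rewrite subKr (mulrC m) divfK ?gt_eqF//.
  have /andP[uvx v0] := uv x; rewrite ler0_norm// lerNl.
  apply: le_trans uvx; case/andP: (uV x) => + _; apply: le_trans.
  by rewrite le_max lexx orbT.
split=> // [x|].
  by rewrite ueq /G /g; ring.
exists (u_lim F h (lam1 * A) Omega); split.
- move=> x; rewrite (u_lim_eq Sb) //; rewrite [F (u_lim _ _ _ _ _)]/F /g_bar; ring.
- by move=> x; exact: (u_lim_bounds Sb).
exists (1 - a / m); split.
- rewrite subr_gt0 ltr_pdivrMr// mul1r am/= ltrBlDr ltrDl.
  exact: divr_gt0.
- by apply: decay => x; rewrite lexx; case/andP: (uV x).
- by apply: decay => x; exact: (u_lim_bounds Sb).
Qed.
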